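(* Let $\mathbb{K}\in\{\mathbb{R},\mathbb{C}\}$, let $X$ and $Y$ be $\mathbb{K}$-operator spaces, and let $f:X\to Y$ be a (not necessarily linear) completely coarse map. If $f(0)=0$, then $f$ is $\mathbb{R}$-linear.
   Context: A (concrete) $\mathbb{K}$-operator space is a closed $\mathbb{K}$-linear subspace $X$ of $B(H)$, where $H$ is a $\mathbb{K}$-Hilbert space and $B(H)$ is the algebra of bounded $\mathbb{K}$-linear operators on $H$. For $n\in\mathbb{N}$, the space $M_n(X)$ of $n\times n$ matrices with entries in $X$ carries the norm $\|\cdot\|_n=\|\cdot\|_{M_n(X)}$ inherited from the identification $M_n(B(H))=B(H^n)$, where $H^n$ is the $\ell_2$-direct sum of $n$ copies of $H$. For a map $f:X\to Y$, its $n$-th amplification is $f_n:M_n(X)\to M_n(Y)$, $f_n([x_{ij}])=[f(x_{ij})]$. The map $f$ is completely coarse if for every $t>0$, $$\sup_{n\in\mathbb{N}}\ \sup\{\|f_n(x)-f_n(y)\|_{M_n(Y)} : x,y\in M_n(X),\ \|x-y\|_{M_n(X)}\le t\}<\infty .$$ *)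

(* Defs.v *)
From HB Require Import structures.
From mathcomp Require Import all_boot all_order all_algebra.
From mathcomp Require Import sesquilinear complex.
From mathcomp Require Import boolp classical_sets functions reals ereal.
From mathcomp Require Import topology normedtype ring.

Set Implicit Arguments.
Unset Strict Implicit.
Unset Printing Implicit Defensive.

Import Order.TTheory GRing.Theory Num.Theory.
Import numFieldNormedType.Exports.

Local Open Scope classical_set_scope.
Local Open Scope ring_scope.

Variant scalar_kind := RealScalars | ComplexScalars.

Definition scalar (R : realType) (k : scalar_kind) : numFieldType :=
  match k with
  | RealScalars => R
  | ComplexScalars => R[i]
  end.

Section ScalarOperations.
Context {R : realType} {k : scalar_kind}.

Definition re_scalar : scalar R k -> R :=
  match k return scalar R k -> R with
  | RealScalars => id
  | ComplexScalars => @complex.Re R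
  end.

Definition of_real : R -> scalar R k :=
  match k return R -> scalar R k with
  | RealScalars => id
  | ComplexScalars => real_complex R
  end.

Definition conj_scalar : scalar R k -> scalar R k :=
  match k return scalar R k -> scalar R k with
  | RealScalars => id
  | ComplexScalars => conjc
  end.

Lemma re_of_real a : re_scalar (of_real a) = a.
Proof. by rewrite /re_scalar /of_real; case: k a => a. Qed.

Lemma of_realK (x : scalar R k) : 0 <= x -> of_real (re_scalar x) = x.
Proof.
rewrite /re_scalar /of_real; case: k x => //= -[a b].
by rewrite lecE /= => /andP[/eqP -> _].
Qed.

Lemma re_scalarD (x y : scalar R k) :
  re_scalar (x + y) = re_scalar x + re_scalar y.
Proof. by rewrite /re_scalar; case: k x y => //= -[a b] [c d]. Qed.

Lemma of_realD a b : of_real (a + b) = of_real a + of_real b.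
Proof. by rewrite /of_real; case: k => //=; rewrite rmorphD. Qed.

Lemma of_realM a b : of_real (a * b) = of_real a * of_real b.
Proof. by rewrite /of_real; case: k => //=; rewrite rmorphM. Qed.

Lemma of_real0 : of_real 0 = 0.
Proof. by rewrite /of_real; case: k. Qed.

Lemma of_real1 : of_real 1 = 1.
Proof. by rewrite /of_real; case: k. Qed.

Lemma ler_of_real a b : (of_real a <= of_real b) = (a <= b).
Proof. by rewrite /of_real; case: k => //=; rewrite lecR. Qed.

Lemma re_norm_of_real a : re_scalar `|of_real a| = `|a|.
Proof.
rewrite /re_scalar /of_real; case: k => //=.
by rewrite expr0n addr0 sqrtr_sqr.
Qed.

End ScalarOperations.

Arguments of_real {R} k _.

(* The norm of a MathComp-Analysis normed module over K is K-valued; [nrm] is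
   the same nonnegative number read in R (see [of_real_nrm]). *)
Definition nrm (R : realType) (k : scalar_kind)
  (V : normedModType (scalar R k)) (v : V) : R := re_scalar `|v|.

Section NrmTheory.
Context {R : realType} {k : scalar_kind} {V : normedModType (scalar R k)}.
Implicit Types u v : V.

Lemma of_real_nrm v : of_real k (nrm v) = `|v|.
Proof. exact: of_realK. Qed.

Lemma nrm_ge0 v : 0 <= nrm v.
Proof. by rewrite -(@ler_of_real R k) of_real0 of_real_nrm. Qed.

Lemma ler_nrmD u v : nrm (u + v) <= nrm u + nrm v.
Proof. by rewrite -(@ler_of_real R k) of_realD !of_real_nrm ler_normD. Qed.

Lemma nrmZ (a : scalar R k) v : nrm (a *: v) = re_scalar `|a| * nrm v.
Proof.
rewrite -[RHS](@re_of_real R k) of_realM of_real_nrm of_realK//.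
by rewrite -normrZ.
Qed.

Lemma nrm0 : nrm (0 : V) = 0.
Proof. by rewrite /nrm normr0 -(@of_real0 R k) re_of_real. Qed.

Lemma nrm_eq0 v : nrm v = 0 -> v = 0.
Proof.
by move=> v0; apply/eqP; rewrite -normr_eq0 -of_real_nrm v0 of_real0.
Qed.

Lemma ler_nrm_sum (I : finType) (F : I -> V) :
  nrm (\sum_i F i) <= \sum_i nrm (F i).
Proof.
apply: (big_ind2 (fun u a => nrm u <= a)) => //; first by rewrite nrm0.
by move=> u a v b ua vb; rewrite (le_trans (ler_nrmD _ _))// lerD.
Qed.

End NrmTheory.

Section BoundedOperators.
Context {R : realType} {k : scalar_kind} (V : normedModType (scalar R k)).

Definition bounded_operator : {pred V -> V} :=
  fun T => `[< linear T /\ exists M : R, forall v, nrm (T v) <= M * nrm v >].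

Record bop := Bop { bop_fun :> V -> V ; _ : bop_fun \in bounded_operator }.

HB.instance Definition _ := [isSub for bop_fun].
HB.instance Definition _ := [Choice of bop by <:].

Lemma bounded_operator_submod_closed : submod_closed bounded_operator.
Proof.
split=> [|a S T].
  apply/asboolP; split=> [b u v|]; first by rewrite scaler0 addr0.
  by exists 0 => v; rewrite mul0r nrm0.
rewrite !unfold_in => /asboolP[Slin [M SM]] /asboolP[Tlin [N TN]]; apply/asboolP; split.
  move=> b u v; rewrite !fctE /= Slin Tlin !scalerDr !scalerA.
  by rewrite [a * b]mulrC addrACA.
exists (re_scalar `|a| * M + N) => v; rewrite !fctE mulrDl -mulrA.
rewrite (le_trans (ler_nrmD _ _))// lerD// nrmZ ler_wpM2l//.
by rewrite -(@ler_of_real R k) of_real0 of_realK.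
Qed.

HB.instance Definition _ := GRing.isSubmodClosed.Build _ _
  bounded_operator bounded_operator_submod_closed.
HB.instance Definition _ := [SubChoice_isSubLmodule of bop by <:].

End BoundedOperators.

Arguments bounded_operator {R k} V.

(* The set is nonempty and bounded above (see [opnorm_ub], [opnorm_le]), so the
   total function [sup] returns its least upper bound. *)
Definition opnorm (R : realType) (k : scalar_kind)
    (V : normedModType (scalar R k)) (T : bop V) : R :=
  sup [set nrm (T v) | v in [set v : V | nrm v <= 1]].

Section OperatorNorm.
Context {R : realType} {k : scalar_kind} {V : normedModType (scalar R k)}.
Implicit Types S T : bop V.

Lemma bop_linear T : linear T.
Proof. by have /asboolP[] := valP T. Qed.

Lemma bop_bounded T : exists M : R, forall v, nrm (T v) <= M * nrm v.
Proof. by have /asboolP[] := valP T. Qed.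

Lemma bop0 T : T 0 = 0.
Proof. by have := bop_linear T (-1) 0 0; rewrite !scaleN1r !addNr. Qed.

Lemma bopZ T a v : T (a *: v) = a *: T v.
Proof. by have := bop_linear T a v 0; rewrite bop0 !addr0. Qed.

Lemma bopD T u v : T (u + v) = T u + T v.
Proof. by have := bop_linear T 1 u v; rewrite !scale1r. Qed.

Lemma bop_addE S T v : (S + T) v = S v + T v.
Proof. by []. Qed.

Lemma bop_scaleE a T v : (a *: T) v = a *: T v.
Proof. by []. Qed.

Lemma opnorm_ub T v : nrm v <= 1 -> nrm (T v) <= opnorm T.
Proof.
move=> v1; apply: ub_le_sup; last by exists v.
have [M TM] := bop_bounded T; exists `|M| => _ [u /= u1 <-].
rewrite (le_trans (TM u))// (le_trans (ler_wpM2r (nrm_ge0 u) (ler_norm M)))//.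
by rewrite -[leRHS]mulr1 ler_wpM2l.
Qed.

Lemma opnorm_le T (c : R) :
  (forall v, nrm v <= 1 -> nrm (T v) <= c) -> opnorm T <= c.
Proof.
move=> Tc; apply: ge_sup => [|_ [v /= v1 <-]]; last exact: Tc.
by exists (nrm (T 0)); exists 0 => //=; rewrite nrm0.
Qed.

Lemma opnorm_ge0 T : 0 <= opnorm T.
Proof. by rewrite (le_trans (nrm_ge0 (T 0)))// opnorm_ub// nrm0. Qed.

Lemma opnormP T v : nrm (T v) <= opnorm T * nrm v.
Proof.
have [/nrm_eq0 ->|v0] := eqVneq (nrm v) 0; first by rewrite bop0 !nrm0 mulr0.
have v_gt0 : 0 < nrm v by rewrite lt0r v0 nrm_ge0.
have := @opnorm_ub T (of_real k (nrm v)^-1 *: v).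
rewrite bopZ !nrmZ (@re_norm_of_real R k) gtr0_norm ?invr_gt0// mulVf//.
by rewrite mulrC ler_pdivrMr// => ->.
Qed.

Lemma opnorm_normD S T :
  of_real k (opnorm (S + T)) <= of_real k (opnorm S) + of_real k (opnorm T).
Proof.
rewrite -of_realD ler_of_real opnorm_le// => v v1.
by rewrite bop_addE (le_trans (ler_nrmD _ _))// lerD// opnorm_ub.
Qed.

Lemma opnorm_normZ (a : scalar R k) T :
  of_real k (opnorm (a *: T)) = `|a| * of_real k (opnorm T).
Proof.
have re_norm_ge0 b : 0 <= re_scalar `|b : scalar R k|.
  by rewrite -(@ler_of_real R k) of_real0 of_realK.
have le_aT b (U : bop V) : opnorm (b *: U) <= re_scalar `|b| * opnorm U.
  by apply: opnorm_le => v v1; rewrite bop_scaleE nrmZ ler_wpM2l ?opnorm_ub.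
rewrite -[in RHS](@of_realK R k `|a|)// -of_realM; congr of_real.
apply/eqP; rewrite eq_le le_aT/=.
have [->|a0] := eqVneq a 0.
  by rewrite normr0 -(@of_real0 R k) re_of_real mul0r opnorm_ge0.
have := ler_wpM2l (re_norm_ge0 a) (le_aT a^-1 (a *: T)).
rewrite scalerA mulVf// scale1r mulrA => /le_trans; apply.
rewrite -[X in X * _](@re_of_real R k) of_realM !of_realK// -normrM divff//.
by rewrite normr1 -(@of_real1 R k) re_of_real mul1r.
Qed.

Lemma opnorm_eq0 T : of_real k (opnorm T) = 0 -> T = 0.
Proof.
move=> /(congr1 re_scalar); rewrite re_of_real -(@of_real0 R k) re_of_real.
move=> T0; apply/val_inj/funext => v; apply: nrm_eq0.
by apply/eqP; rewrite eq_le nrm_ge0 andbT (le_trans (opnormP T v))// T0 mul0r.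
Qed.

HB.instance Definition _ := Lmodule_isNormed.Build (scalar R k) (bop V)
  opnorm_normD opnorm_normZ opnorm_eq0.

Lemma nrm_opnorm T : nrm T = opnorm T.
Proof. by rewrite /nrm re_of_real. Qed.

End OperatorNorm.

(* The l2-direct sum of n copies of V; an alias of ['I_n -> V], so that its norm
   is the l2 norm below. *)
Definition hsum (n : nat) (V : Type) : Type := 'I_n -> V.

Section HilbertSum.
Context {R : realType} {k : scalar_kind} {V : normedModType (scalar R k)}.
Context {n : nat}.
Implicit Types xi eta : hsum n V.

HB.instance Definition _ := GRing.Lmodule.copy (hsum n V) ('I_n -> V).

Definition l2norm xi : R := Num.sqrt (\sum_i nrm (xi i) ^+ 2).

Lemma l2norm_ge0 xi : 0 <= l2norm xi. Proof. exact: sqrtr_ge0. Qed.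

Lemma sqr_l2norm xi : l2norm xi ^+ 2 = \sum_i nrm (xi i) ^+ 2.
Proof. by rewrite sqr_sqrtr// sumr_ge0// => i _; rewrite sqr_ge0. Qed.

Lemma ler_l2norm xi i : nrm (xi i) <= l2norm xi.
Proof.
rewrite -ler_sqr ?nnegrE ?nrm_ge0 ?l2norm_ge0// sqr_l2norm (bigD1 i)//=.
by rewrite lerDl sumr_ge0// => j _; rewrite sqr_ge0.
Qed.

Lemma cauchy_schwarz (a b : 'I_n -> R) :
  (\sum_i a i * b i) ^+ 2 <= (\sum_i a i ^+ 2) * (\sum_i b i ^+ 2).
Proof.
set A := \sum_i a i ^+ 2; set B := \sum_i b i ^+ 2; set C := \sum_i a i * b i.
have A0 : 0 <= A by apply: sumr_ge0 => i _; rewrite sqr_ge0.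
have [A_eq0|A_neq0] := eqVneq A 0.
  suff -> : C = 0 by rewrite A_eq0 expr0n mul0r.
  apply: big1 => i _; have : a i ^+ 2 == 0.
    rewrite eq_le sqr_ge0 andbT -A_eq0 /A (bigD1 i)//= lerDl.
    by rewrite sumr_ge0// => j _; rewrite sqr_ge0.
  by rewrite sqrf_eq0 => /eqP ->; rewrite mul0r.
have A_gt0 : 0 < A by rewrite lt0r A_neq0.
have : 0 <= \sum_i (A * b i - C * a i) ^+ 2.
  by apply: sumr_ge0 => i _; rewrite sqr_ge0.
rewrite (_ : \sum_i _ = A * (A * B - C ^+ 2)) ?pmulr_rge0 ?subr_ge0//.
transitivity (\sum_i (A ^+ 2 * b i ^+ 2 - 2 * A * C * (a i * b i)
                      + C ^+ 2 * a i ^+ 2)).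
  by apply: eq_bigr => i _; ring.
by rewrite big_split sumrB -!mulr_sumr -/A -/B -/C /=; ring.
Qed.

Lemma l2norm_normD xi eta :
  of_real k (l2norm (xi + eta)) <= of_real k (l2norm xi) + of_real k (l2norm eta).
Proof.
rewrite -of_realD ler_of_real -ler_sqr ?nnegrE ?addr_ge0 ?l2norm_ge0//.
apply: (@le_trans _ _ (\sum_i (nrm (xi i) + nrm (eta i)) ^+ 2)).
  rewrite sqr_l2norm; apply: ler_sum => i _.
  by rewrite ler_sqr ?nnegrE ?addr_ge0 ?nrm_ge0// ler_nrmD.
under eq_bigr do rewrite sqrrD.
rewrite !big_split/= -!sqr_l2norm sqrrD lerD2r lerD2l -mulr2n lerMn2r/=.
rewrite -ler_sqr ?nnegrE ?mulr_ge0 ?l2norm_ge0//; last first.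
  by apply: sumr_ge0 => i _; rewrite mulr_ge0 ?nrm_ge0.
by rewrite exprMn !sqr_l2norm cauchy_schwarz.
Qed.

Lemma l2norm_normZ (a : scalar R k) xi :
  of_real k (l2norm (a *: xi)) = `|a| * of_real k (l2norm xi).
Proof.
rewrite -[in RHS](@of_realK R k `|a|)// -of_realM; congr of_real.
have a0 : 0 <= re_scalar `|a| by rewrite -(@ler_of_real R k) of_real0 of_realK.
rewrite -[re_scalar _]ger0_norm// -sqrtr_sqr -sqrtrM ?sqr_ge0//.
by rewrite mulr_sumr; congr Num.sqrt; apply: eq_bigr => i _; rewrite nrmZ exprMn.
Qed.

Lemma l2norm_eq0 xi : of_real k (l2norm xi) = 0 -> xi = 0.
Proof.
move=> /(congr1 re_scalar); rewrite re_of_real -(@of_real0 R k) re_of_real.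
move=> xi0; apply/funext => i; apply: nrm_eq0; apply/eqP.
by rewrite eq_le nrm_ge0 andbT -xi0 ler_l2norm.
Qed.

HB.instance Definition _ := Lmodule_isNormed.Build (scalar R k) (hsum n V)
  l2norm_normD l2norm_normZ l2norm_eq0.

Lemma nrm_l2norm xi : nrm xi = l2norm xi.
Proof. by rewrite /nrm re_of_real. Qed.

Definition mxop_fun (x : 'M[bop V]_n) (xi : hsum n V) : hsum n V :=
  fun i => \sum_j x i j (xi j).

Lemma mxop_subproof (x : 'M[bop V]_n) : mxop_fun x \in bounded_operator (hsum n V).
Proof.
apply/asboolP; split=> [a xi eta|].
  apply/funext => i; rewrite /mxop_fun !fctE scaler_sumr -big_split/=.
  by apply: eq_bigr => j _; rewrite bop_linear.
exists (Num.sqrt (\sum_i (\sum_j opnorm (x i j)) ^+ 2)) => xi.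
rewrite !nrm_l2norm -ler_sqr ?nnegrE ?mulr_ge0 ?sqrtr_ge0//.
rewrite exprMn sqr_l2norm sqr_sqrtr; last first.
  by rewrite sumr_ge0// => i _; rewrite sqr_ge0.
rewrite mulr_suml; apply: ler_sum => i _; rewrite -exprMn.
rewrite ler_sqr ?nnegrE ?nrm_ge0//; last first.
  by rewrite mulr_ge0 ?l2norm_ge0// sumr_ge0// => j _; rewrite opnorm_ge0.
rewrite (le_trans (ler_nrm_sum _))// mulr_suml ler_sum// => j _.
by rewrite (le_trans (opnormP _ _))// ler_wpM2l ?opnorm_ge0 ?ler_l2norm.
Qed.

Definition mxop (x : 'M[bop V]_n) : bop (hsum n V) := Bop (mxop_subproof x).

End HilbertSum.

(* As in [sesquilinear], the form [inner] is linear in its first argument and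
   conjugate-linear in the second. *)
Record hilbertSpace (R : realType) (k : scalar_kind) := HilbertSpace {
  hilbert_sort :> completeNormedModType (scalar R k) ;
  inner : {dot hilbert_sort for @conj_scalar R k} ;
  innerE : forall u, inner u u = `|u| ^+ 2
}.

Record operatorSpace (R : realType) (k : scalar_kind) := OperatorSpace {
  ambient : hilbertSpace R k ;
  carrier : {pred bop ambient} ;
  carrier_submod_closed : submod_closed carrier ;
  carrier_closed : closed [set T | T \in carrier]
}.

Arguments carrier {R k} X _ : rename.
Arguments carrier_closed {R k} X : rename.

Record elements (R : realType) (k : scalar_kind) (X : operatorSpace R k) :=
  Element { element_val :> bop (ambient X) ; _ : element_val \in carrier X }.

Coercion elements : operatorSpace >-> Sortclass.

Section Elements.
Context {R : realType} {k : scalar_kind} (X : operatorSpace R k).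

HB.instance Definition _ := [isSub for @element_val R k X].
HB.instance Definition _ := [Choice of X by <:].
HB.instance Definition _ := GRing.isSubmodClosed.Build _ _
  (carrier X) (carrier_submod_closed X).
HB.instance Definition _ := [SubChoice_isSubLmodule of X by <:].

End Elements.

Section CompletelyCoarse.
Context {R : realType} {k : scalar_kind}.

(* ['M[X]_n] carries the norm of B(H^n), not MathComp-Analysis's entrywise
   maximum norm on matrices. *)
Definition mxnorm (X : operatorSpace R k) (n : nat) (x : 'M[X]_n) : R :=
  opnorm (mxop (map_mx val x)).

Definition amplification (X Y : operatorSpace R k) (f : X -> Y) (n : nat)
  (x : 'M[X]_n) : 'M[Y]_n := map_mx f x.

Definition completely_coarse (X Y : operatorSpace R k) (f : X -> Y) : Prop :=
  forall t : R, 0 < t ->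
    (ereal_sup
      [set ereal_sup
        [set (mxnorm (amplification f p.1 - amplification f p.2))%:E
          | p in [set p : 'M[X]_n * 'M[X]_n | (mxnorm (p.1 - p.2) <= t)%R]]
        | n in [set n : nat | (0 < n)%N]] < +oo)%E.

Definition real_linear (X Y : operatorSpace R k) (f : X -> Y) : Prop :=
  forall (a : R) (x y : X),
    f (of_real k a *: x + y) = of_real k a *: f x + f y.

End CompletelyCoarse.

(* Main.v *)
(** Entrywise, a matrix [h (x) S] with S a Hadamard matrix of order m^2 has norm
    only m |h|, but applying f to a perturbation along it, from base points a or
    b + h according to the sign, produces, up to a bounded term, a multiple of
    the all-ones matrix, whose norm is m^2.  Complete coarseness then bounds
    f(a+h) - f(a) - (f(b+h) - f(b)) by O(m^-2) when |h| = O(m^-1).  Summing m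
    such steps, the error O(m^-1) vanishes, so increments of f do not depend on
    the base point and f is additive; being bounded on balls, it is R-linear. *)

From HB Require Import structures.
From mathcomp Require Import all_boot all_order all_algebra.
From mathcomp Require Import reals.
From mathcomp Require Import sesquilinear boolp ereal.
From mathcomp Require Import normedtype ring.
Require Import Defs.

Set Implicit Arguments.
Unset Strict Implicit.
Unset Printing Implicit Defensive.

Import Order.TTheory GRing.Theory Num.Theory.

Local Open Scope ring_scope.

Lemma subrACA (V : zmodType) (x y z w : V) : x - y - (z - w) = x - z - (y - w).
Proof. by rewrite !opprB addrACA [w - y]addrC addrACA [w - z]addrC addrACA. Qed.

(** * Norms read in [R], and the parallelogram law *)

Section Norms.
Context {R : realType} {k : scalar_kind}.

Lemma of_real_inj : injective (@of_real R k).
Proof. exact: can_inj re_of_real. Qed.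

Lemma nrmN (V : normedModType (scalar R k)) (v : V) : nrm (- v) = nrm v.
Proof. by rewrite /nrm normrN. Qed.

Lemma ler_nrmB (V : normedModType (scalar R k)) (u v : V) :
  nrm (u - v) <= nrm u + nrm v.
Proof. by rewrite -[nrm v]nrmN ler_nrmD. Qed.

Lemma nrmMn (V : normedModType (scalar R k)) (v : V) n :
  nrm (v *+ n) = n%:R * nrm v.
Proof.
apply: of_real_inj; rewrite of_real_nrm normrMn mulr_natl -of_real_nrm.
by elim: n => [|n IHn]; rewrite ?mulr0n ?of_real0// !mulrS of_realD IHn.
Qed.

Lemma nrmZ_real (V : normedModType (scalar R k)) (a : R) (v : V) :
  nrm (of_real k a *: v) = `|a| * nrm v.
Proof. by rewrite nrmZ re_norm_of_real. Qed.

(** Both sides expand through [inner] in the scalar field, and injectivity of [of_real] brings the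
    identity back to [R]. This is where the Hilbert structure enters the proof. *)
Lemma parallelogram (H : hilbertSpace R k) (u v : H) :
  nrm (u + v) ^+ 2 + nrm (u - v) ^+ 2 = (nrm u ^+ 2 + nrm v ^+ 2) *+ 2.
Proof.
have of_real_sqr_nrm (w : H) : of_real k (nrm w ^+ 2) = inner H w w.
  by rewrite innerE expr2 of_realM of_real_nrm.
apply: of_real_inj; rewrite mulr2n !of_realD !of_real_sqr_nrm.
rewrite !(linearDl, linearDr, linearNl, linearNr) /=; ring.
Qed.

End Norms.

(** * Hadamard matrices acting on Hilbert sums *)

Section Hadamard.
Context {R : realType} {k : scalar_kind} (H : hilbertSpace R k).

(** Orthogonality in operator form: the sign matrix, with [true] standing for -1, acts on H^n as
    sqrt(n) times an isometry. *)
Definition hadamard n (S : 'M[bool]_n) : Prop :=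
  forall v : 'I_n -> H,
    \sum_i nrm (\sum_j (-1) ^+ S i j *: v j) ^+ 2 = n%:R * \sum_j nrm (v j) ^+ 2.

(** Sylvester's doubling: the two block rows give a + b and a - b, and the parallelogram law
    supplies the factor 2. *)
Lemma hadamard_double n (S : 'M[bool]_n) :
  hadamard S -> hadamard (block_mx S S S (map_mx negb S)).
Proof.
move=> hS v; rewrite !big_split_ord/=.
pose a i := \sum_j (-1) ^+ S i j *: v (lshift n j).
pose b i := \sum_j (-1) ^+ S i j *: v (rshift n j).
transitivity (\sum_i nrm (a i + b i) ^+ 2 + \sum_i nrm (a i - b i) ^+ 2).
  congr (_ + _); apply: eq_bigr => i _; congr (nrm _ ^+ 2).
    rewrite big_split_ord/=; congr (_ + _); apply: eq_bigr => j _.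
      by rewrite block_mxEul.
    by rewrite block_mxEur.
  rewrite big_split_ord/= -sumrN; congr (_ + _); apply: eq_bigr => j _.
    by rewrite block_mxEdl.
  by rewrite block_mxEdr mxE signrN scaleNr.
rewrite -big_split/=; under eq_bigr do rewrite parallelogram.
rewrite sumrMnl big_split/= !hS natrD; ring.
Qed.

End Hadamard.

(** [S] is chosen before [H] because the same sign matrix later acts over the ambient spaces of both
    [X] and [Y]. *)
Lemma hadamard_exists (R : realType) (k : scalar_kind) p :
  exists S : 'M[bool]_(2 ^ p), forall H : hilbertSpace R k, hadamard H S.
Proof.
elim: p => [|p [S hS]].
  by exists (const_mx false) => H v; rewrite !big_ord1 mxE scale1r mul1r.
rewrite expnS mul2n -addnn; eexists => H; exact: hadamard_double (hS H).
Qed.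

(** * Norms of constant and signed operator matrices *)

Section MatrixNorms.
Context {R : realType} {k : scalar_kind} (X : operatorSpace R k).
Implicit Types x : X.

Lemma element_eq0 x : nrm (val x) = 0 -> x = 0.
Proof. by move/nrm_eq0 => x0; apply: val_inj. Qed.

Lemma ler_mxnormD n (x y : 'M[X]_n) : mxnorm (x + y) <= mxnorm x + mxnorm y.
Proof.
rewrite /mxnorm -!nrm_opnorm.
suff -> : mxop (map_mx val (x + y)) = mxop (map_mx val x) + mxop (map_mx val y).
  exact: ler_nrmD.
apply/val_inj/funext => v; apply/funext => i.
transitivity (\sum_j (val (x i j) (v j) + val (y i j) (v j))).
  by apply: eq_bigr => j _; rewrite !mxE raddfD.
by rewrite big_split/=; congr (_ + _); apply: eq_bigr => j _; rewrite mxE.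
Qed.

Lemma mxnorm_const n x :
  mxnorm (const_mx x : 'M[X]_n) = n%:R * nrm (val x).
Proof.
have sqr_const (v : ambient X) :
    l2norm (fun _ : 'I_n => v) ^+ 2 = n%:R * nrm v ^+ 2.
  by rewrite sqr_l2norm sumr_const card_ord mulr_natl.
have mxopE v : mxop (map_mx val (const_mx x : 'M[X]_n)) v =
    (fun _ => val x (\sum_j v j)).
  apply/funext => i /=; rewrite /mxop_fun.
  rewrite (big_morph (val x) (bopD (val x)) (bop0 _)).
  by apply: eq_bigr => j _; rewrite !mxE.
apply/eqP; rewrite eq_le; apply/andP; split.
  (* Upper bound: every coordinate of the image is [val x] of the sum of the [v j], and by
     Cauchy-Schwarz that sum has squared norm at most n. *)
  apply: opnorm_le => v; rewrite mxopE !nrm_l2norm => v1.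
  rewrite -ler_sqr ?nnegrE ?l2norm_ge0 ?mulr_ge0 ?nrm_ge0// sqr_const exprMn expr2 -!mulrA.
  rewrite ler_wpM2l//.
  apply: (@le_trans _ _ (opnorm (val x) ^+ 2 * (\sum_j nrm (v j)) ^+ 2)).
    rewrite -exprMn ler_sqr ?nnegrE ?nrm_ge0 ?mulr_ge0 ?opnorm_ge0//; last first.
      by rewrite sumr_ge0// => j _; rewrite nrm_ge0.
    by rewrite (le_trans (opnormP _ _))// ler_wpM2l ?opnorm_ge0// ler_nrm_sum.
  rewrite nrm_opnorm mulrC ler_wpM2r ?sqr_ge0//.
  have := cauchy_schwarz (fun _ => 1) (fun j => nrm (v j)).
  under eq_bigr do rewrite mul1r.
  move/le_trans; apply; rewrite sumr_const card_ord expr1n.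
  by rewrite -[leRHS]mulr1 ler_wpM2l// -sqr_l2norm expr_le1 ?l2norm_ge0.
(* Lower bound, by testing on constant vectors, whose coordinates sum to n v. Order 0 is set apart
   because n is divided out. *)
case: n sqr_const mxopE => [|n] sqr_const mxopE.
  by rewrite mul0r opnorm_ge0.
rewrite -ler_pdivlMl// nrm_opnorm; apply: opnorm_le => v v1.
have := opnormP (mxop (map_mx val (const_mx x : 'M[X]_n.+1))) (fun _ => v).
rewrite mxopE sumr_const card_ord !nrm_l2norm ler_pdivlMl// -/(mxnorm _).
rewrite -ler_sqr ?nnegrE ?mulr_ge0 ?l2norm_ge0 ?opnorm_ge0//.
have -> : val x (v *+ n.+1) = val x v *+ n.+1.
  by rewrite -[v *+ _]scaler_nat bopZ scaler_nat.
rewrite exprMn !sqr_const nrmMn [leRHS]mulrCA ler_pM2l// => h.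
rewrite -ler_sqr ?nnegrE ?mulr_ge0 ?nrm_ge0 ?opnorm_ge0// (le_trans h)//.
by rewrite -[leRHS]mulr1 ler_wpM2l ?sqr_ge0// expr_le1 ?nrm_ge0.
Qed.

Definition signed_mx n (S : 'M[bool]_n) x : 'M[X]_n :=
  \matrix_(i, j) ((-1) ^+ S i j *: x).

(** The matrix applies [val x] to each coordinate and then the signs; order m^2 makes the Hadamard
    factor sqrt(m^2) = m. *)
Lemma mxnorm_signed m (S : 'M[bool]_(m ^ 2)) x :
  hadamard (ambient X) S -> mxnorm (signed_mx S x) <= m%:R * nrm (val x).
Proof.
move=> hS; apply: opnorm_le => v; rewrite !nrm_l2norm => v1.
rewrite -ler_sqr ?nnegrE ?l2norm_ge0 ?mulr_ge0 ?nrm_ge0// exprMn sqr_l2norm.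
rewrite (eq_bigr (fun i =>
  nrm (\sum_j (-1) ^+ S i j *: val x (v j)) ^+ 2)); last first.
  move=> i _; congr (nrm _ ^+ 2); apply: eq_bigr => j _.
  by rewrite !mxE linearZ.
rewrite hS natrX ler_wpM2l ?sqr_ge0//.
apply: (@le_trans _ _ (\sum_j nrm (val x) ^+ 2 * nrm (v j) ^+ 2)).
  apply: ler_sum => j _; rewrite -exprMn ler_sqr ?nnegrE ?mulr_ge0 ?nrm_ge0//.
  by rewrite nrm_opnorm opnormP.
rewrite -mulr_sumr -sqr_l2norm -[leRHS]mulr1 ler_wpM2l ?sqr_ge0//.
by rewrite expr_le1 ?l2norm_ge0.
Qed.

End MatrixNorms.

Lemma completely_coarseP (R : realType) (k : scalar_kind)
    (X Y : operatorSpace R k) (f : X -> Y) (t : R) :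
  completely_coarse f -> 0 < t ->
  exists C : R, forall n (x y : 'M[X]_n), (0 < n)%N -> mxnorm (x - y) <= t ->
    mxnorm (map_mx f x - map_mx f y) <= C.
Proof.
move=> cf t0; have := cf t t0; set s := ereal_sup _ => s_lty.
exists (fine s) => n x y n0 xyt.
have le_s : ((mxnorm (map_mx f x - map_mx f y))%:E <= s)%E.
  apply: le_trans (ereal_sup_ubound _); last by exists n.
  by apply: ereal_sup_ubound; exists (x, y).
(* [s] is finite: below +oo by coarseness, above -oo because it dominates a real norm. *)
by rewrite -lee_fin fineK// fin_numElt s_lty (lt_le_trans _ le_s)// ltNyr.
Qed.

(** * Increments of [f] under a bound uniform in the matrix order *)

Section Additivity.
Context {R : realType} {k : scalar_kind} {X Y : operatorSpace R k}.
Context (f : X -> Y) (t C : R).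
Context (fC : forall n (x y : 'M[X]_n), (0 < n)%N -> mxnorm (x - y) <= t ->
  mxnorm (map_mx f x - map_mx f y) <= C).

(** Constant matrices of order n magnify a single increment by the factor n. *)
Lemma increment_bound n (a h : X) : (0 < n)%N -> n%:R * nrm (val h) <= t ->
  n%:R * nrm (val (f (a + h) - f a)) <= C.
Proof.
move=> n0; rewrite -!mxnorm_const => ht.
have := @fC n (const_mx (a + h)) (const_mx a) n0.
have -> : const_mx (a + h) - const_mx a = const_mx h :> 'M_n.
  by apply/matrixP => i j; rewrite !mxE addrC addKr.
have -> : map_mx f (const_mx (a + h)) - map_mx f (const_mx a) =
    const_mx (f (a + h) - f a) :> 'M_n.
  by apply/matrixP => i j; rewrite !mxE.
exact.
Qed.

Lemma increment_diff_bound p (a b h : X) (m := (2 ^ p)%N) :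
  m%:R * nrm (val h) <= t ->
  m%:R ^+ 2 * nrm (val (f (a + h) - f a - (f (b + h) - f b))) <= 4 * C.
Proof.
move=> ht; have m0 : (0 < m)%N by rewrite expn_gt0.
have [S hS] : exists S : 'M[bool]_(m ^ 2),
    forall H : hilbertSpace R k, hadamard H S.
  by rewrite -expnM; exact: hadamard_exists.
set u := f (a + h) - f a; set w := f (b + h) - f b.
(* [e + e] is the constant matrix [u - w] plus the signed matrix of [u + w]. *)
pose x := \matrix_(i, j) if S i j then b else a + h.
pose y := \matrix_(i, j) if S i j then b + h else a.
pose e := map_mx f x - map_mx f y.
(* Although of order m^2, the matrix x - y has norm at most m |h| <= t, being the signed matrix of
   h. *)
have eC : mxnorm e <= C.
  apply: fC; first by rewrite expn_gt0 m0.
  suff -> : x - y = signed_mx S h by exact: le_trans (mxnorm_signed _ (hS _)) _.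
  apply/matrixP => i j; rewrite !mxE; case: (S i j).
    by rewrite scaleN1r opprD addNKr.
  by rewrite scale1r addrC addKr.
have -> : m%:R ^+ 2 * nrm (val (u - w)) =
    mxnorm (e + e + signed_mx S (- (u + w))).
  rewrite -natrX -mxnorm_const; congr mxnorm; apply/matrixP => i j.
  rewrite !mxE; case: (S i j); rewrite ?scaleN1r ?scale1r.
    by rewrite -[f b - f (b + h)]opprB -/w opprK [u + w]addrC addrA addrNK addrC.
  by rewrite -/u [RHS]addrKA.
(* Bounds at order m suffice here, since the signed matrix of order m^2 has norm at most m |u + w|
   <= 2C. The summand e + e gives the other 2C. *)
have uC : m%:R * nrm (val u) <= C by exact: increment_bound.
have wC : m%:R * nrm (val w) <= C by exact: increment_bound.
have uwC : mxnorm (signed_mx S (- (u + w))) <= C + C.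
  apply: le_trans (mxnorm_signed _ (hS _)) _.
  rewrite raddfN nrmN raddfD (le_trans (ler_wpM2l _ (ler_nrmD _ _)))//.
  by rewrite mulrDr lerD.
rewrite (le_trans (ler_mxnormD _ _))// (le_trans (lerD (ler_mxnormD _ _) uwC))//.
by rewrite (_ : 4 * C = C + C + (C + C)) ?lerD//; ring.
Qed.

(** Each of the m steps contributes at most 4C / m^2, hence 4C / m in total. *)
Lemma increment_diff_telescope p (a b h : X) (m := (2 ^ p)%N) :
  m%:R * nrm (val h) <= t ->
  m%:R * nrm (val (f (a + h *+ m) - f a - (f (b + h *+ m) - f b))) <= 4 * C.
Proof.
move=> ht; have m0 : (0 : R) < m%:R by rewrite ltr0n expn_gt0.
have := fun i => increment_diff_bound (a + h *+ i) (b + h *+ i) ht.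
rewrite -/m; move: {ht} m m0 => {p} m m0 stepC.
pose D i := f (a + h *+ i) - f (b + h *+ i).
have -> : f (a + h *+ m) - f a - (f (b + h *+ m) - f b) =
    \sum_(0 <= i < m) (D i.+1 - D i).
  by rewrite telescope_sumr// /D mulr0n !addr0 subrACA.
(* The extra factor m creates the m^2 needed for the bound on each step. *)
rewrite big_mkord raddf_sum -(@ler_pM2l _ m%:R)//.
rewrite mulrA -expr2 (le_trans (ler_wpM2l _ (ler_nrm_sum _)))// ?exprn_ge0//.
rewrite mulr_sumr (le_trans (ler_sum _ (G := fun _ => 4 * C) _))//.
  move=> i _; rewrite /D subrACA !(mulrSr h) !addrA; exact: stepC.
by rewrite sumr_const card_ord -[leLHS]mulr_natl.
Qed.

End Additivity.

(** * Vanishing by Archimedean arguments *)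

Lemma exp2_bounded_eq0 (R : realType) (d C : R) :
  0 <= d -> (forall p, (2 ^ p)%:R * d <= C) -> d = 0.
Proof.
move=> d0 dC; apply/eqP; rewrite eq_le d0 andbT leNgt; apply/negP => d_gt0.
have C0 : 0 <= C / d by rewrite divr_ge0// (le_trans _ (dC 0%N))// mulr_ge0.
(* [N] exceeds C / d, and N < 2^N contradicts the bound at p = N. *)
have := archi_boundP C0; set N := Num.bound _; apply/negP.
rewrite -leNgt ler_pdivlMr// (le_trans _ (dC N))// ler_wpM2r// ler_nat.
by rewrite ltnW// ltn_expl.
Qed.

(** [F] kills the integers, so 2^p F(a) is the value of [F] at the fractional part of 2^p a; thus
    2^p |F(a)| <= M for every p. *)
Lemma bounded_additive_eq0 (R : realType) (k : scalar_kind)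
    (V : normedModType (scalar R k)) (F : {additive R -> V}) (M : R) :
  F 1 = 0 -> (forall r, 0 <= r <= 1 -> nrm (F r) <= M) -> forall a, F a = 0.
Proof.
move=> F1 FM a; apply/nrm_eq0/(@exp2_bounded_eq0 _ _ M) => [|p].
  exact: nrm_ge0.
have /andP[le_floor lt_floor] := floor_itv (a *+ 2 ^ p).
rewrite -nrmMn -raddfMn -[F _]subr0 -(mul0rz _ (Num.floor (a *+ 2 ^ p))) -F1.
rewrite -raddfMz -raddfB; apply: FM.
by rewrite subr_ge0 le_floor/= lerBlDr addrC -[X in _ + X]/(1%:~R) -intrD ltW.
Qed.

(** * Increments of completely coarse maps *)

Section CompletelyCoarseMaps.
Context {R : realType} {k : scalar_kind} {X Y : operatorSpace R k}.
Context (f : X -> Y) (cf : completely_coarse f).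

Lemma completely_coarse_increment (a b h : X) :
  f (a + h) - f a = f (b + h) - f b.
Proof.
(* Adding 1 keeps the radius positive when h = 0. The resulting [C] is fixed before p, so all
   subdivisions of h share it. *)
have t0 : 0 < nrm (val h) + 1 by rewrite ltr_wpDl ?nrm_ge0.
have [C fC] := completely_coarseP cf t0.
apply/eqP; rewrite -subr_eq0; apply/eqP/element_eq0.
apply: (@exp2_bounded_eq0 _ _ (4 * C)) => [|p]; first exact: nrm_ge0.
have m0 : (2 ^ p)%:R != 0 :> scalar R k by rewrite pnatr_eq0 -lt0n expn_gt0.
(* Cutting h into 2^p equal pieces gives 2^p |h'| = |h|, which stays within the radius. *)
pose h' := (2 ^ p)%:R^-1 *: h.
have h'K : h' *+ 2 ^ p = h by rewrite -scaler_nat scalerA divff// scale1r.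
rewrite -h'K; apply: (increment_diff_telescope fC).
by rewrite -nrmMn -raddfMn h'K lerDl.
Qed.

(** Matrices of order 1 suffice, since |r x| <= |x| for r in [0, 1]. *)
Lemma completely_coarse_bounded (x : X) :
  exists C, forall r : R, 0 <= r <= 1 ->
    nrm (val (f (of_real k r *: x) - f 0)) <= C.
Proof.
have t0 : 0 < nrm (val x) + 1 by rewrite ltr_wpDl ?nrm_ge0.
have [C fC] := completely_coarseP cf t0; exists C => r /andP[r0 r1].
have := @increment_bound _ _ _ _ f _ C fC 1 0 (of_real k r *: x) isT.
rewrite !mul1r add0r; apply; rewrite linearZ nrmZ_real ger0_norm//.
by rewrite (le_trans (ler_piMl _ r1)) ?nrm_ge0// lerDl.
Qed.

End CompletelyCoarseMaps.

Theorem theorem1p1 (R : realType) (k : scalar_kind) (X Y : operatorSpace R k)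
    (f : X -> Y) :
  completely_coarse f -> f 0 = 0 -> real_linear f.
Proof.
move=> cf f0.
have fD x y : f (x + y) = f x + f y.
  apply/eqP; rewrite [f x + _]addrC -subr_eq.
  by rewrite (completely_coarse_increment cf x 0 y) add0r f0 subr0.
suff fZ (a : R) (x : X) : f (of_real k a *: x) = of_real k a *: f x.
  by move=> a x y; rewrite fD fZ.
(* The defect of homogeneity along x: additive in b, zero at b = 1 and bounded on [0, 1], hence
   zero. It is valued in [bop (ambient Y)], where [nrm] is available. *)
pose F (b : R) : bop (ambient Y) :=
  val (f (of_real k b *: x) - of_real k b *: f x).
have FD : {morph F : b c / b + c}.
  by move=> b c; rewrite /F of_realD !scalerDl fD opprD addrACA raddfD.
have FB : zmod_morphism F.
  by move=> b c; apply/eqP; rewrite eq_sym subr_eq -FD subrK.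
pose FA := GRing.isZmodMorphism.Build _ _ F FB.
pose Fadd : {additive R -> bop (ambient Y)} := HB.pack F FA.
have [C fC] := completely_coarse_bounded cf x.
suff : Fadd a = 0.
  by rewrite /= /F => Fa0; apply/eqP; rewrite -subr_eq0; apply/eqP/val_inj.
apply: (@bounded_additive_eq0 _ _ _ _ (C + nrm (val (f x)))).
  by rewrite /= /F of_real1 !scale1r subrr.
move=> r /[dup] /fC; rewrite f0 subr0 => frC /andP[r0 r1].
have -> : Fadd r = val (f (of_real k r *: x)) - of_real k r *: val (f x).
  by rewrite /= /F linearB; congr (_ - _); rewrite linearZ.
rewrite (le_trans (ler_nrmB _ _))// lerD//.
rewrite nrmZ_real ger0_norm//.
by rewrite (le_trans (ler_piMl _ r1)) ?nrm_ge0.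
Qed.
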